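(* Let $H=(V,E)$ be a connected hypergraph without empty edges, and $v\in V$. Then $v$ is a separating vertex of $H$ if and only if $v$ lies in more than one block of $H$.
   Context: A hypergraph $H=(V,E)$ consists of a nonempty finite vertex set $V$, a finite edge set $E$, and an incidence function $\psi:E\to 2^V$; edges are identified with their vertex sets (parallel edges allowed); an empty edge has empty vertex set. Two distinct vertices are adjacent via $e$ if both lie in $e$; a walk is a sequence $v_0e_1v_1\dots e_kv_k$ with $v_{i-1},v_i$ adjacent via $e_i$; $H$ is connected if any two distinct vertices are joined by a walk. A hypersubgraph of $H$ is a hypergraph $(V',E')$ with $\emptyset\ne V'\subseteq V$, $E'\subseteq E$. A vertex $v$ is a separating vertex of a connected hypergraph $K$ without empty edges if there are two connected hypersubgraphs $K_1,K_2$ of $K$, each with at least one edge, with $E(K_1)\cap E(K_2)=\emptyset$, $V(K)=V(K_1)\cup V(K_2)$, $E(K)=E(K_1)\cup E(K_2)$, and $V(K_1)\cap V(K_2)=\{v\}$. A hypergraph is non-separable if it is connected, has no empty edges and has no separating vertices. A block of $H$ is a maximal non-separable hypersubgraph of $H$. *)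

(* Defs.v *)
From mathcomp Require Import all_boot.

Set Implicit Arguments.
Unset Strict Implicit.
Unset Printing Implicit Defensive.

(* Hypergraphs are carved out of ambient finite types [V] of vertices and [E]
   of edge names sharing one incidence function [psi], so that a hypergraph and
   its hypersubgraphs have the same type, and distinct edge names may have equal
   vertex sets (parallel edges).  Only the values of [psi] on [edges] matter.
   Both side conditions are boolean, so two hypergraphs with the same [vertices]
   and [edges] are equal. *)
Record hypergraph (V E : finType) (psi : E -> {set V}) := Hypergraph {
  vertices : {set V};
  edges : {set E};
  _ : vertices != set0;
  _ : [forall e in edges, psi e \subset vertices] }.

Section Hypergraphs.

Variables (V E : finType) (psi : E -> {set V}).
Implicit Types (H K B : hypergraph psi) (u v w : V) (e : E).

Definition hypersubgraph K H : bool :=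
  (vertices K \subset vertices H) && (edges K \subset edges H).

Definition no_empty_edges H : Prop :=
  forall e, e \in edges H -> psi e != set0.

Definition adjacent_via H e u w : bool :=
  [&& e \in edges H, u != w, u \in psi e & w \in psi e].

(* [walk H v0 [:: (e1, v1); ...; (ek, vk)] w] says that v0 e1 v1 ... ek vk is a
   walk of [H] and that vk = w. *)
Fixpoint walk H v (p : seq (E * V)) w : bool :=
  if p is (e, u) :: q then adjacent_via H e v u && walk H u q w
  else (v \in vertices H) && (v == w).

Definition connected H : Prop :=
  forall u w, u \in vertices H -> w \in vertices H -> u != w ->
  exists p, walk H u p w.

(* Meaningful for connected [K] without empty edges. *)
Definition separating_vertex K v : Prop :=
  exists K1 K2,
    [/\ hypersubgraph K1 K /\ hypersubgraph K2 K,
        connected K1 /\ connected K2,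
        edges K1 != set0 /\ edges K2 != set0,
        edges K1 :&: edges K2 = set0 /\ edges K = edges K1 :|: edges K2
      & vertices K = vertices K1 :|: vertices K2 /\
        vertices K1 :&: vertices K2 = [set v]].

Definition non_separable H : Prop :=
  [/\ connected H, no_empty_edges H & forall v, ~ separating_vertex H v].

Definition block H B : Prop :=
  [/\ hypersubgraph B H, non_separable B
    & forall B', hypersubgraph B' H -> non_separable B' ->
      hypersubgraph B B' -> B' = B].

End Hypergraphs.

(* Main.v *)
Require Import Defs.
From mathcomp Require Import all_boot.
From Stdlib Require Import Classical_Prop.

(** If [K] splits as [K1] and [K2] meeting only in [v], then a non-separable
    hypersubgraph [B] of [K] lies in [K1] or in [K2], since otherwise its
    intersections with [K1] and [K2] would separate it at [v].

    If [v] separates [H] into [K1] and [K2], repeated splitting of each [Ki]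
    yields a non-separable hypersubgraph of [Ki] that contains [v] and an edge;
    the blocks extending these two hypersubgraphs lie in [K1] and [K2]
    respectively, and are distinct because [K1] and [K2] share no edge.

    Conversely let [v] lie in two blocks, and argue by induction on the number of
    edges.  [H] is not non-separable, so it has a separating vertex [u].  If
    [u <> v], both blocks lie in the part containing [v], so [v] separates that
    part; attaching the other part at [u] gives a separation of [H] at [v]. *)

Section Blocks.

Variables (V E : finType) (psi : E -> {set V}).
Implicit Types (H K L B : hypergraph psi) (X : {set V}) (u v w : V) (e : E).

(** * Basic facts on hypergraphs and hypersubgraphs *)

Lemma edge_sub {H e} : e \in edges H -> psi e \subset vertices H.
Proof. by case: H => A F A0 /forall_inP sFA /=; apply: sFA. Qed.

Lemma edge_vertex {H e u} : e \in edges H -> u \in psi e -> u \in vertices H.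
Proof. by move=> /edge_sub /subsetP; apply. Qed.

Lemma hypergraph_ext H K :
  vertices H = vertices K -> edges H = edges K -> H = K.
Proof.
case: H K => [A F A0 sF] [A' F' A0' sF'] /= eqA eqF; subst.
by rewrite (bool_irrelevance A0 A0') (bool_irrelevance sF sF').
Qed.

Lemma hypergraph_exists (A : {set V}) (F : {set E}) u :
    u \in A -> (forall e, e \in F -> psi e \subset A) ->
  exists K : hypergraph psi, vertices K = A /\ edges K = F.
Proof.
move=> Au sFA; have A0 : A != set0 by apply/set0Pn; exists u.
have sF : [forall e in F, psi e \subset A] by apply/forall_inP.
by exists (Hypergraph A0 sF).
Qed.

Lemma hypersubgraph_refl H : hypersubgraph H H.
Proof. by rewrite /hypersubgraph !subxx. Qed.

Lemma hypersubgraph_trans {K H L} :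
  hypersubgraph H K -> hypersubgraph K L -> hypersubgraph H L.
Proof.
move=> /andP[sV sE] /andP[sV' sE'].
by rewrite /hypersubgraph (subset_trans sV) ?(subset_trans sE).
Qed.

Lemma hypersubgraph_anti H K :
  hypersubgraph H K -> hypersubgraph K H -> H = K.
Proof.
move=> /andP[sV sE] /andP[sV' sE'].
by apply: hypergraph_ext; apply/eqP; rewrite eqEsubset ?sV ?sE.
Qed.

Lemma no_empty_edges_sub {K H} :
  hypersubgraph K H -> no_empty_edges H -> no_empty_edges K.
Proof. by move=> /andP[_ /subsetP sE] neH e /sE/neH. Qed.

(** * Connectedness through edge-closed vertex sets *)

Definition edge_closed H X :=
  forall e u, e \in edges H -> u \in psi e -> u \in X -> psi e \subset X.

Lemma walk_closed H X u p w :
  edge_closed H X -> u \in X -> walk H u p w -> w \in X.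
Proof.
move=> clX; elim: p u => [|[e u'] p IHp] u Xu /=; first by case/andP=> _ /eqP <-.
case/andP=> /and4P[He _ eu eu']; apply: IHp.
exact: (subsetP (clX e u He eu Xu)).
Qed.

(** Replaces walks by closed sets. A walk cannot leave a closed set; conversely, the set of vertices
    reachable from [u] is closed, so it is everything. *)
Lemma connected_closedP H :
  connected H <->
  (forall X u, u \in vertices H -> u \in X -> edge_closed H X ->
     vertices H \subset X).
Proof.
split=> [connH X u Hu Xu clX | clH u w Hu Hw _].
  apply/subsetP=> w Hw; have [<- //|neq_uw] := eqVneq u w.
  by have [p /walk_closed ->] := connH u w Hu Hw neq_uw.
(* Unlike [adjacent_via], [r] allows [x = y]; such stationary steps are dropped when a path is
   turned into a walk. *)
pose r x y := [exists e in edges H, (x \in psi e) && (y \in psi e)].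
pose X := [set x | connect r u x].
have clX : edge_closed H X.
  move=> e x He ex; rewrite inE => ux; apply/subsetP=> y ey; rewrite inE.
  by apply/(connect_trans ux)/connect1/exists_inP; exists e; rewrite ?ex.
have := clH X u Hu; rewrite inE => /(_ (connect0 _ _) clX) /subsetP/(_ w Hw).
rewrite inE => /connectP[p + ->].
elim: p u Hu {Hw X clX} => [|x p IHp] u Hu /=.
  by exists [::]; rewrite /= Hu eqxx.
case/andP=> /exists_inP[e He /andP[eu ex]] /IHp[].
  exact: edge_vertex ex.
move=> q walkq; have [-> |neq_ux] := eqVneq u x; first by exists q.
by exists ((e, x) :: q); rewrite /= /adjacent_via He neq_ux eu ex.
Qed.

(** [vertices K] is edge-closed in [B] and meets [B] at [u]. Hence, once [B] has a nonempty edge,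
    inclusion in [K] need only be checked on edges. *)
Lemma connected_edges_sub B K e u :
    connected B -> e \in edges B -> u \in psi e -> edges B \subset edges K ->
  vertices B \subset vertices K.
Proof.
move=> /connected_closedP connB Be eu /subsetP sBK.
apply: (connB _ u); [exact: edge_vertex eu | exact: edge_vertex (sBK _ Be) eu |].
by move=> e' x /sBK /edge_sub.
Qed.

Lemma connected_no_edges B u :
  connected B -> edges B = set0 -> u \in vertices B -> vertices B = [set u].
Proof.
move=> /connected_closedP connB B0 Bu; apply/eqP.
rewrite eqEsubset sub1set Bu andbT; apply: (connB _ u) => //; first exact: set11.
by move=> e x; rewrite B0 in_set0.
Qed.

(** A closed set meeting one part contains that part, hence [u], hence the other part. *)
Lemma connected_union K K1 K2 u :
    connected K1 -> connected K2 -> u \in vertices K1 -> u \in vertices K2 ->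
    vertices K = vertices K1 :|: vertices K2 ->
    edges K = edges K1 :|: edges K2 ->
  connected K.
Proof.
move=> /connected_closedP c1 /connected_closedP c2 u1 u2 eqV eqE.
apply/connected_closedP=> X x; rewrite eqV => Kx Xx clX.
have cl1 : edge_closed K1 X.
  by move=> e y Ke; apply: clX; rewrite eqE inE Ke.
have cl2 : edge_closed K2 X.
  by move=> e y Ke; apply: clX; rewrite eqE inE Ke orbT.
have Xu : u \in X.
  case/setUP: Kx => Kx; first by move/subsetP: (c1 X x Kx Xx cl1); apply.
  by move/subsetP: (c2 X x Kx Xx cl2); apply.
by rewrite subUset (c1 X u) ?(c2 X u).
Qed.

(** * Separations at a vertex, with the two parts named *)

Definition separation K v K1 K2 :=
    [/\ hypersubgraph K1 K /\ hypersubgraph K2 K,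
        connected K1 /\ connected K2,
        edges K1 != set0 /\ edges K2 != set0,
        edges K1 :&: edges K2 = set0 /\ edges K = edges K1 :|: edges K2
      & vertices K = vertices K1 :|: vertices K2 /\
        vertices K1 :&: vertices K2 = [set v]].

Lemma separation_sym {K v K1 K2} : separation K v K1 K2 -> separation K v K2 K1.
Proof.
case=> [[? ?] [? ?] [? ?] [I0 eqE] [eqV Iv]].
by split; split=> //; rewrite 1?setIC // setUC.
Qed.

(** The other part has an edge of its own. This makes the number of edges a measure for induction on
    parts. *)
Lemma separation_card {K v K1 K2} :
  separation K v K1 K2 -> #|edges K1| < #|edges K|.
Proof.
case=> _ _ [_ E2] [I0 ->] _.
by rewrite cardsU I0 cards0 subn0 -[X in X < _]addn0 ltn_add2l card_gt0.
Qed.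

Lemma separation_vertex {K v K1 K2} :
  separation K v K1 K2 -> v \in vertices K1 /\ v \in vertices K2.
Proof. by case=> _ _ _ _ [_ Iv]; apply/setIP; rewrite Iv set11. Qed.

Lemma separation_common {K v K1 K2} u :
  separation K v K1 K2 -> u \in vertices K1 -> u \in vertices K2 -> u = v.
Proof.
by case=> _ _ _ _ [_ Iv] u1 u2; apply/set1P; rewrite -Iv inE u1.
Qed.

(** An edge-closed set of [B1] yields one of [B]: add all of [B2] if the set contains [v], otherwise
    cut it down to [B1]. *)
Lemma connected_part B B1 B2 v :
    connected B -> vertices B = vertices B1 :|: vertices B2 ->
    edges B = edges B1 :|: edges B2 ->
    vertices B1 :&: vertices B2 = [set v] ->
  connected B1.
Proof.
move=> /connected_closedP connB eqV eqE Iv.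
have [v1 v2] : v \in vertices B1 /\ v \in vertices B2.
  by apply/setIP; rewrite Iv set11.
have common x : x \in vertices B1 -> x \in vertices B2 -> x = v.
  by move=> x1 x2; apply/set1P; rewrite -Iv inE x1.
apply/connected_closedP=> X x B1x Xx clX.
have [Xv|nXv] := boolP (v \in X).
  have /subsetP sBX : vertices B \subset X :|: vertices B2.
    apply: (connB _ v); rewrite ?eqV ?inE ?v1 ?Xv // => e y; rewrite eqE.
    case/setUP=> Be ey Uy; last by rewrite subsetU ?edge_sub ?orbT.
    rewrite subsetU // (clX e y) //; case/setUP: Uy => // B2y.
    by rewrite (common y) // (edge_vertex Be ey).
  apply/subsetP=> y B1y; have: y \in X :|: vertices B2.
    by rewrite sBX // eqV inE B1y.
  by case/setUP=> // B2y; rewrite (common y).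
(* An edge of [B2] could meet this set only at [v], which is not in [X]. *)
have /subsetP sBX : vertices B \subset X :&: vertices B1.
  apply: (connB _ x); rewrite ?eqV ?inE ?B1x ?Xx // => e y; rewrite eqE.
  case/setUP=> Be ey /setIP[Xy B1y]; first by rewrite subsetI (clX e y) ?edge_sub.
  by rewrite -(common y B1y (edge_vertex Be ey)) Xy in nXv.
have /sBX/setIP[Xv _] : v \in vertices B by rewrite eqV inE v1.
by rewrite Xv in nXv.
Qed.

(** If the edges of [B] all lie on one side, so do its vertices. If both sides have edges of [B],
    then [v] is in [B] and the two traces of [B], connected by [connected_part], form a separation
    of [B]. *)
Lemma non_separable_sub_part K v K1 K2 B :
    separation K v K1 K2 -> non_separable B -> hypersubgraph B K ->
  hypersubgraph B K1 \/ hypersubgraph B K2.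
Proof.
move=> sepK [connB neB nsepB] /andP[sV sE].
have [_ _ _ [I0 eqE] [eqV Iv]] := sepK.
have [v1 v2] := separation_vertex sepK.
have /set0Pn[x Bx] : vertices B != set0 by case: (B).
have [B0|/set0Pn[e0 Be0]] := eqVneq (edges B) set0.
  rewrite /hypersubgraph B0 !sub0set !andbT (connected_no_edges _ x) // !sub1set.
  by apply/setUP; rewrite -eqV (subsetP sV).
have one_sided L : edges B \subset edges L -> hypersubgraph B L.
  move=> sBL; rewrite /hypersubgraph sBL andbT.
  by have /set0Pn[y] := neB _ Be0; move/(connected_edges_sub B L); apply.
have eqEB : edges B = (edges B :&: edges K1) :|: (edges B :&: edges K2).
  by rewrite -setIUr -eqE; apply/esym/setIidPl.
have [E2|/set0Pn[e2 /setIP[Be2 K2e2]]] := eqVneq (edges B :&: edges K2) set0.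
  by left; apply/one_sided/setIidPl; rewrite {2}eqEB E2 setU0.
have [E1|/set0Pn[e1 /setIP[Be1 K1e1]]] := eqVneq (edges B :&: edges K1) set0.
  by right; apply/one_sided/setIidPl; rewrite {2}eqEB E1 set0U.
have /set0Pn[x1 ex1] := neB _ Be1; have /set0Pn[x2 ex2] := neB _ Be2.
(* Without [v], no edge of [B] leads from [K1] to [K2], so all of [B] lies in [K1]; but then [x2]
   lies in both parts and equals [v]. *)
have Bv : v \in vertices B.
  have [//|nBv] := boolP (v \in vertices B).
  have /subsetP sBK1 : vertices B \subset vertices B :&: vertices K1.
    move/connected_closedP: connB; apply; first exact: edge_vertex ex1.
      by rewrite inE (edge_vertex Be1) ?(edge_vertex K1e1).
    move=> e y Be ey /setIP[By K1y]; rewrite subsetI edge_sub //.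
    have:= subsetP sE _ Be; rewrite eqE => /setUP[/edge_sub // | K2e].
    case/negP: nBv; rewrite -(separation_common y sepK) //.
    exact: edge_vertex ey.
  have Bx2 := edge_vertex Be2 ex2; case/setIP: (sBK1 _ Bx2) => _ K1x2.
  have eq_x2 := separation_common x2 sepK K1x2 (edge_vertex K2e2 ex2).
  by rewrite -eq_x2 Bx2 in nBv.
have part L : v \in vertices L -> exists BL : hypergraph psi,
    vertices BL = vertices B :&: vertices L /\ edges BL = edges B :&: edges L.
  move=> Lv; apply: (hypergraph_exists _ _ v); first by rewrite inE Bv.
  by move=> e /setIP[Be Le]; rewrite subsetI !edge_sub.
have [B1 [VB1 EB1]] := part _ v1; have [B2 [VB2 EB2]] := part _ v2.
have eqVB : vertices B = vertices B1 :|: vertices B2.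
  by rewrite VB1 VB2 -setIUr -eqV; apply/esym/setIidPl.
have eqEB' : edges B = edges B1 :|: edges B2 by rewrite EB1 EB2.
have IB : vertices B1 :&: vertices B2 = [set v].
  by rewrite VB1 VB2 -setIIr Iv; apply/setIidPr; rewrite sub1set.
case: (nsepB v); exists B1, B2; split; split=> //.
- by rewrite /hypersubgraph VB1 EB1 !subsetIl.
- by rewrite /hypersubgraph VB2 EB2 !subsetIl.
- exact: (connected_part B B1 B2 v).
- by apply: (connected_part B B2 B1 v); rewrite // 1?setUC // setIC.
- by apply/set0Pn; exists e1; rewrite EB1 inE Be1.
- by apply/set0Pn; exists e2; rewrite EB2 inE Be2.
- by rewrite EB1 EB2 -setIIr I0 setI0.
Qed.

(** * Existence of non-separable hypersubgraphs and of blocks *)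

Lemma separable_or_non_separable K :
    connected K -> no_empty_edges K ->
  non_separable K \/ exists u K1 K2, separation K u K1 K2.
Proof.
move=> cK neK; have [sepK|nsepK] := classic (exists u, separating_vertex K u).
  by right.
by left; split=> // u sepu; case: nsepK; exists u.
Qed.

(** Strong induction on the number of edges, passing to a part that contains [v]. Every part has an
    edge, so the induction never reaches an edgeless hypergraph. *)
Lemma non_separable_at K v :
    connected K -> no_empty_edges K -> edges K != set0 -> v \in vertices K ->
  exists B, [/\ hypersubgraph B K, non_separable B, edges B != set0
              & v \in vertices B].
Proof.
have [n] := ubnP #|edges K|; elim: n K => // n IHn K /ltnSE leKn cK neK K0 Kv.
have [|[u [K1 [K2 sepK]]]] := separable_or_non_separable K cK neK.
  by exists K; split=> //; apply: hypersubgraph_refl.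
have in_part L L' : separation K u L L' -> v \in vertices L ->
    exists B, [/\ hypersubgraph B K, non_separable B, edges B != set0
                & v \in vertices B].
  move=> sepL Lv; have [[sL _] [cL _] [L0 _] _ _] := sepL.
  have ltL := leq_trans (separation_card sepL) leKn.
  have [B [sB nsB B0 Bv]] := IHn L ltL cL (no_empty_edges_sub sL neK) L0 Lv.
  by exists B; split=> //; apply: hypersubgraph_trans sL.
have [_ _ _ _ [eqV _]] := sepK.
move: Kv; rewrite eqV => /setUP[]; first exact: in_part sepK.
exact: in_part (separation_sym sepK).
Qed.

Lemma sub_block H B :
    hypersubgraph B H -> non_separable B ->
  exists B', block H B' /\ hypersubgraph B B'.
Proof.
pose gap L := #|vertices H :\: vertices L| + #|edges H :\: edges L|.
have [n] := ubnP (gap B); elim: n B => // n IHn B /ltnSE leBn sB nsB.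
have [[B' [sB' nsB' sBB' neqB]]|maxB] := classic (exists B',
    [/\ hypersubgraph B' H, non_separable B', hypersubgraph B B' & B' <> B]).
  have ltB' : gap B' < n.
    (* If the gap did not drop, [B] and [B'] would miss the same vertices and edges of [H], hence be
       equal. *)
    apply: leq_trans leBn; rewrite ltnNge; apply/negP=> leBB'; apply: neqB.
    have /andP[sV sE] := sBB'; have /andP[sV' sE'] := sB'.
    have leV := subset_leq_card (setDS (vertices H) sV).
    have leE := subset_leq_card (setDS (edges H) sE).
    apply: hypersubgraph_anti => //; apply/andP; split.
      have: vertices H :\: vertices B == vertices H :\: vertices B'.
        rewrite eq_sym eqEcard setDS //= -(leq_add2r #|edges H :\: edges B'|).
        by apply: leq_trans leBB'; rewrite leq_add2l.
      move/eqP/setP=> eqD; apply/subsetP=> x B'x; move: (eqD x).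
      by rewrite !inE B'x (subsetP sV' _ B'x) andbT /= => /negbFE.
    have: edges H :\: edges B == edges H :\: edges B'.
      rewrite eq_sym eqEcard setDS //= -(leq_add2l #|vertices H :\: vertices B'|).
      by apply: leq_trans leBB'; rewrite leq_add2r.
    move/eqP/setP=> eqD; apply/subsetP=> x B'x; move: (eqD x).
    by rewrite !inE B'x (subsetP sE' _ B'x) andbT /= => /negbFE.
  have [C [blC sC]] := IHn B' ltB' sB' nsB'.
  by exists C; split=> //; apply: hypersubgraph_trans sC.
exists B; split; last exact: hypersubgraph_refl.
split=> // B' sB' nsB' sBB'; apply: NNPP => neqB.
by apply: maxB; exists B'.
Qed.

(** * Passing between a hypergraph and one part of a separation *)

Lemma block_sub H K B :
  hypersubgraph K H -> hypersubgraph B K -> block H B -> block K B.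
Proof.
move=> sK sB [_ nsB maxB]; split=> // B' sB' nsB' sBB'.
by apply: maxB => //; apply: hypersubgraph_trans sK.
Qed.

(** As [u] differs from [v], it lies in only one side of the separation of [K1], say [M1]. Gluing
    [K2] to [M1] at [u] gives a connected side that still meets [M2] only in [v]. *)
Lemma separating_vertex_part K u K1 K2 v :
    separation K u K1 K2 -> v != u -> separating_vertex K1 v ->
  separating_vertex K v.
Proof.
move=> sepK neq_vu [M1 [M2 sepM]].
have [u1 u2] := separation_vertex sepK.
wlog M1u : M1 M2 sepM / u \in vertices M1.
  move=> wlogM; have [_ _ _ _ [eqV _]] := sepM.
  move: (u1); rewrite eqV => /setUP[M1u|M2u]; first exact: (wlogM M1 M2).
  exact: wlogM (separation_sym sepM) M2u.
have [[/andP[sK1V sK1E] /andP[sK2V sK2E]] [cK1 cK2] [K1n0 K2n0] [IE EK] [VK IV]]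
  := sepK.
have [[/andP[sM1V sM1E] /andP[sM2V sM2E]] [cM1 cM2] [M1n0 M2n0] [JE EM] [VM JV]]
  := sepM.
have [M1v M2v] := separation_vertex sepM.
have M2u : u \notin vertices M2.
  apply: contra neq_vu => M2u.
  by rewrite (separation_common u sepM).
have [||L [VL EL]] := hypergraph_exists (vertices M1 :|: vertices K2)
    (edges M1 :|: edges K2) u; first by rewrite inE M1u.
  by move=> e /setUP[] /edge_sub se; rewrite subsetU ?se ?orbT.
exists L, M2; split; split=> //.
- by rewrite /hypersubgraph VL EL VK EK !setSU.
- by rewrite /hypersubgraph VK EK !subsetU ?sM2V ?sM2E.
- exact: (connected_union L M1 K2 u).
- by rewrite EL -card_gt0 (leq_trans _ (subset_leq_card (subsetUl _ _))) ?card_gt0.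
- rewrite EL setIUl JE set0U; apply/eqP; rewrite -subset0 -IE setIC.
  by rewrite setSI.
- by rewrite EL EK EM setUAC.
- by rewrite VL VK VM setUAC.
(* A common vertex of [K2] and [M2] is also in [K1], so it is [u], which [M2] avoids. *)
- rewrite VL setIUl JV; apply/setUidPl/subsetP=> x /setIP[K2x M2x].
  have eq_xu := separation_common x sepK (subsetP sM2V x M2x) K2x.
  by rewrite -eq_xu M2x in M2u.
Qed.

Lemma two_blocks_separating H v B1 B2 :
    connected H -> no_empty_edges H -> block H B1 -> block H B2 -> B1 <> B2 ->
    v \in vertices B1 -> v \in vertices B2 ->
  separating_vertex H v.
Proof.
have [n] := ubnP #|edges H|.
elim: n H => // n IHn H /ltnSE leHn cH neH bl1 bl2 neqB B1v B2v.
have [[sB1 nsB1 max1] [sB2 nsB2 max2]] := (bl1, bl2).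
have [nsH|[u [K1 [K2 sepH]]]] := separable_or_non_separable H cH neH.
  (* By maximality, both blocks would be [H] itself. *)
  have sHH := hypersubgraph_refl H.
  by case: neqB; rewrite -(max1 H) // -(max2 H).
have [->|neq_vu] := eqVneq v u; first by exists K1, K2.
wlog sB1K1 : K1 K2 sepH / hypersubgraph B1 K1.
  have [sK1|sK2] := non_separable_sub_part _ _ _ _ _ sepH nsB1 sB1.
    by move/(_ K1 K2); apply.
  by move/(_ K2 K1); apply=> //; apply: separation_sym.
(* Were [B2] in [K2], then [v] would lie in both parts and equal [u]. *)
have sB2K1 : hypersubgraph B2 K1.
  have [//|/andP[sV _]] := non_separable_sub_part _ _ _ _ _ sepH nsB2 sB2.
  have /andP[sV' _] := sB1K1.
  by case/eqP: neq_vu; apply: (separation_common v sepH);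
    rewrite ?(subsetP sV) ?(subsetP sV').
have [[sK1 _] [cK1 _] _ _ _] := sepH.
apply: (separating_vertex_part _ _ _ _ _ sepH neq_vu).
apply: IHn (leq_trans (separation_card sepH) leHn) cK1 _ _ _ neqB B1v B2v.
- exact: no_empty_edges_sub neH.
- exact: block_sub bl1.
- exact: block_sub bl2.
Qed.

(** The block extends a hypersubgraph with an edge in [K1]; that edge is not in [K2], so the block
    cannot lie there. *)
Lemma separation_block H v K1 K2 :
    no_empty_edges H -> separation H v K1 K2 ->
  exists B, [/\ block H B, hypersubgraph B K1, edges B != set0
              & v \in vertices B].
Proof.
move=> neH sepH; have [v1 _] := separation_vertex sepH.
have [[sK1 _] [cK1 _] [K1n0 _] [IE _] _] := sepH.
have [B0 [sB0 nsB0 B0n0 B0v]] :=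
  non_separable_at _ _ cK1 (no_empty_edges_sub sK1 neH) K1n0 v1.
have [B [blB /andP[sV sE]]] := sub_block _ _ (hypersubgraph_trans sB0 sK1) nsB0.
have [sB nsB _] := blB.
have /set0Pn[e B0e] := B0n0; have Be := subsetP sE _ B0e.
exists B; split=> //; last exact: subsetP sV _ B0v.
  have [//|/andP[_ sK2]] := non_separable_sub_part _ _ _ _ _ sepH nsB sB.
  have /andP[_ sK1E] := sB0; have := in_set0 e.
  by rewrite -IE inE (subsetP sK1E) ?(subsetP sK2).
by apply/set0Pn; exists e.
Qed.

End Blocks.

Theorem theorem3p39 (V E : finType) (psi : E -> {set V}) (H : hypergraph psi)
    (v : V) (H_conn : connected H) (H_nonempty : no_empty_edges H)
    (v_in : v \in vertices H) :
  separating_vertex H v <->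
  exists B1 B2 : hypergraph psi,
    [/\ block H B1, block H B2, B1 <> B2,
        v \in vertices B1 & v \in vertices B2].
Proof.
split=> [[K1 [K2 sepH]] | [B1 [B2 [bl1 bl2 neqB B1v B2v]]]]; last first.
  exact: two_blocks_separating neqB B1v B2v.
have [B1 [bl1 /andP[_ sB1] B1n0 B1v]] :=
  separation_block _ _ _ _ _ _ _ H_nonempty sepH.
have [B2 [bl2 /andP[_ sB2] _ B2v]] :=
  separation_block _ _ _ _ _ _ _ H_nonempty (separation_sym _ _ _ sepH).
(* If the blocks were equal, an edge of [B1] would belong to both [K1] and [K2]. *)
exists B1, B2; split=> // eqB; have [_ _ _ [IE _] _] := sepH.
have /set0Pn[e B1e] := B1n0; have := in_set0 e.
by rewrite -IE inE (subsetP sB1) ?(subsetP sB2) // -eqB.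
Qed.
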